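(* Let $\mathcal{G}=([n],\mathcal{E})$ be a connected graph and let $\{X(t),A(t,X(t))\}_{t\ge 0}$ be the stochastic process generated by the dynamics $$W(t+1)=A(t,X(t))X(t),\qquad X(t+1)=W(t+1)-\alpha(t+1)G(t+1),$$ with filtration $\{\mathcal{F}_t\}_{t\ge 0}$ as described in the context. Suppose that for every $t\ge 0$ the matrix $A(t,X(t))$ is $\mathcal{F}_{t+1}$-measurable and doubly stochastic. Let $i^*,j^*\in[n]$ be the random indices (depending on $t$) defined by the max-edge $e_{\max}(X(t))=\{i^*,j^*\}$, and suppose that there is $\delta>0$ such that $$\mathbb{E}\big[A(t,X(t))^TA(t,X(t))\mid\mathcal{F}_t\big]_{i^*j^*}\ge\delta\quad\text{a.s.}$$ for all $t\ge 0$ and all $X(0)\in\mathbb{R}^{n\times d}$. Then, for all $t\ge0$, $$\mathbb{E}\big[V\big(A(t,X(t))X(t)\big)\mid\mathcal{F}_t\big]\le\lambda\,V(X(t))\quad\text{a.s.},$$ where $\lambda=1-\dfrac{2\delta}{(n-1)\,\mathrm{diam}(\mathcal{G})^2}$.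
   Context: There are $n\ge 2$ agents, $[n]=\{1,\dots,n\}$, and $\mathcal{G}=([n],\mathcal{E})$ is an undirected communication graph. $\mathrm{diam}(\mathcal{G})$ is the longest shortest-path length between two nodes. Each agent $i$ has a convex function $f_i:\mathbb{R}^d\to\mathbb{R}$. State matrices: $X(t)\in\mathbb{R}^{n\times d}$ has $i$-th row $\mathbf{x}_i(t)^T$, $W(t)$ has $i$-th row $\mathbf{w}_i(t)^T$, and $G(t)$ has $i$-th row $\mathbf{g}_i(t)^T$, where $\mathbf{g}_i(t)\in\partial f_i(\mathbf{w}_i(t))$ is a subgradient of $f_i$ at $\mathbf{w}_i(t)$. The $\alpha(t)$, $t\ge1$, are step-sizes. $A(t,X(t))$ is a (possibly random) $n\times n$ averaging matrix with non-negative entries that may depend on $t$ and the state $X(t)$. The initial matrix $X(0)\in\mathbb{R}^{n\times d}$ is arbitrary. $\mathcal{F}_t$ is the $\sigma$-algebra generated by $X(0),\dots,X(t)$ and $A(0,X(0)),\dots,A(t-1,X(t-1))$ (so it does not include $A(t,X(t))$). For $X=[\mathbf{x}_1,\dots,\mathbf{x}_n]^T\in\mathbb{R}^{n\times d}$, the max-edge is $e_{\max}(X)=\arg\max_{\{i,j\}\in\mathcal{E}}\|\mathbf{x}_i-\mathbf{x}_j\|$ (Euclidean norm), with ties broken by choosing the lexicographically smallest index pair. The Lyapunov function is $V(X)=\sum_{i=1}^n\|\mathbf{x}_i-\bar{\mathbf{x}}\|^2$ with $\bar{\mathbf{x}}=\frac1n\sum_{i=1}^n\mathbf{x}_i$.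 A non-negative square matrix is stochastic if each row sums to one, and doubly stochastic if it and its transpose are stochastic. For a matrix $M$, $M_{ij}$ (also $[\,\cdot\,]_{ij}$) denotes its $(i,j)$ entry. *)

(* Defs.v *)
From HB Require Import structures.
From mathcomp Require Import all_boot all_order all_algebra.
From mathcomp Require Import all_classical all_reals all_analysis.
From mathcomp Require Import measurable_realfun.

Set Implicit Arguments.
Unset Strict Implicit.
Unset Printing Implicit Defensive.

Import Order.TTheory GRing.Theory Num.Theory.
Import numFieldNormedType.Exports.

Local Open Scope classical_set_scope.
Local Open Scope ring_scope.

Section graph.
Context {n : nat}.
Implicit Type e : rel 'I_n.

Definition simple_graph e : Prop := symmetric e /\ irreflexive e.

Definition connected_graph e : Prop := forall i j, connect e i j.

Definition has_walk e (i j : 'I_n) (k : nat) : bool :=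
  [exists p : k.-tuple 'I_n, path e i p && (last i p == j)].

(* Length of a shortest path. A shortest walk is a path and has fewer than n
   edges, so the search can stop at n; the value is n when j is not reachable
   from i. *)
Definition gdist e (i j : 'I_n) : nat := find (has_walk e i j) (iota 0 n).

Definition diam e : nat := \max_(i < n) \max_(j < n) gdist e i j.

End graph.

Section linear.
Context {R : realType}.

Definition dot {d} (u v : 'rV[R]_d) : R := \sum_k u 0 k * v 0 k.

(* The library's norm on matrices is the max-norm, hence this one. *)
Definition enorm {d} (u : 'rV[R]_d) : R := Num.sqrt (\sum_k u 0 k ^+ 2).

Definition row_mean {n d} (X : 'M[R]_(n, d)) : 'rV[R]_d :=
  n%:R^-1 *: \sum_i row i X.

Definition lyapunov {n d} (X : 'M[R]_(n, d)) : R :=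
  \sum_i enorm (row i X - row_mean X) ^+ 2.

Definition stochastic {n} (A : 'M[R]_n) : Prop :=
  (forall i j, 0 <= A i j) /\ (forall i, \sum_j A i j = 1).

Definition doubly_stochastic {n} (A : 'M[R]_n) : Prop :=
  stochastic A /\ stochastic A^T.

Definition subgradient {d} (f : 'rV[R]_d -> R) (x g : 'rV[R]_d) : Prop :=
  forall y, f x + dot g (y - x) <= f y.

Definition lex_le {n} (p q : 'I_n * 'I_n) : Prop :=
  (p.1 < q.1)%N \/ p.1 = q.1 /\ (p.2 <= q.2)%N.

(* An undirected edge {i, j} is represented by the pair (i, j) with i < j. *)
Definition is_max_edge {n d} (e : rel 'I_n) (X : 'M[R]_(n, d))
    (p : 'I_n * 'I_n) : Prop :=
  let len (q : 'I_n * 'I_n) := enorm (row q.1 X - row q.2 X) in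
  [/\ (p.1 < p.2)%N, e p.1 p.2 &
      forall q : 'I_n * 'I_n, (q.1 < q.2)%N -> e q.1 q.2 ->
        len q <= len p /\ (len q = len p -> lex_le p q)].

End linear.

Section probability.
Context {disp : measure_display} {T : measurableType disp} {R : realType}.

(* Preimages generating the sigma-algebra of a random matrix: the Borel
   sigma-algebra of R^(m x n) is the one generated by the entries. *)
Definition mx_events {m n} (M : T -> 'M[R]_(m, n)) : set (set T) :=
  [set B | exists i j (U : set R),
     measurable U /\ B = (fun w => M w i j) @^-1` U].

Definition measurable_mx {m n} (F : set (set T)) (M : T -> 'M[R]_(m, n)) :=
  mx_events M `<=` F.

(* The value at time t of a random matrix A depending on time and state, along
   the state process X. *)
Definition along {m n k l} (A : nat -> 'M[R]_(m, n) -> T -> 'M[R]_(k, l))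
    (X : nat -> T -> 'M[R]_(m, n)) (t : nat) (w : T) : 'M[R]_(k, l) :=
  A t (X t w) w.

(* The sigma-algebra of X 0, ..., X t and A 0, ..., A t.-1. *)
Definition history {m n k l} (X : nat -> T -> 'M[R]_(m, n))
    (A : nat -> T -> 'M[R]_(k, l)) (t : nat) : set (set T) :=
  <<s (\bigcup_(s in [set s | (s <= t)%N]) mx_events (X s)) `|`
      (\bigcup_(s in [set s | (s < t)%N]) mx_events (A s)) >>.

Variable P : probability T R.

Definition is_condexp (F : set (set T)) (Z : T -> R) (Y : T -> \bar R) : Prop :=
  (forall U : set (\bar R), measurable U -> F (Y @^-1` U)) /\
  (forall B, F B -> (\int[P]_(w in B) Y w = \int[P]_(w in B) (Z w)%:E)%E).

(* A version of E[Z | F], for Z non-negative (in which case it need not be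
   integrable) or integrable; it is unique up to a null set, and condexpP shows
   that the default value cst 0 is not used when Z is non-negative. *)
Definition condexp (F : set (set T)) (Z : T -> R) : T -> \bar R :=
  xget (cst 0%E) [set Y | is_condexp F Z Y].

Definition condexp_mx {m n} (F : set (set T)) (M : T -> 'M[R]_(m, n))
    (w : T) : 'M[\bar R]_(m, n) :=
  \matrix_(i, j) condexp F (fun w' => M w' i j) w.

Section existence.
Variables (F : set (set T)) (Z : T -> R).
Hypotheses (sF : sigma_algebra setT F) (FT : F `<=` measurable).
Hypotheses (mZ : measurable_fun setT Z) (Z0 : forall w, 0 <= Z w).

Local Notation S := (g_sigma_algebraType F).

Let measS : (@measurable _ S) = F.
Proof. exact: measurable_g_measurableTypeE. Qed.

Let measST (B : set S) : measurable B -> measurable (B : set T).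
Proof. by rewrite measS => /FT. Qed.

Let mEZ : measurable_fun setT (EFin \o Z).
Proof. exact/measurable_EFinP. Qed.

Definition restr_proba : set S -> \bar R := P.

Let PS0 : restr_proba set0 = 0%E. Proof. exact: measure0. Qed.
Let PS_ge0 B : (0 <= restr_proba B)%E. Proof. exact: measure_ge0. Qed.
Let PS_sigma : semi_sigma_additive restr_proba.
Proof.
move=> B mB tB mUB; apply: measure_semi_sigma_additive => //.
- by move=> k; apply: measST.
- exact: measST.
Qed.

HB.instance Definition _ :=
  isMeasure.Build _ S R restr_proba PS0 PS_ge0 PS_sigma.

Let PS_setT : restr_proba setT = 1%E. Proof. exact: probability_setT. Qed.

HB.instance Definition _ :=
  Measure_isProbability.Build _ _ _ restr_proba PS_setT.

(* Z need not be integrable: apply Radon-Nikodym on each {k <= Z < k + 1} and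
   sum the derivatives. *)
Definition slice (k : nat) : set T := Z @^-1` `[k%:R, k.+1%:R[.

Let mlevel k : measurable (slice k).
Proof. by rewrite -[slice k]setTI; apply: mZ => //; exact: measurable_itv. Qed.

Definition slice_measure (k : nat) (B : set S) : \bar R :=
  (\int[P]_(w in B `&` slice k) (Z w)%:E)%E.

Let slice0 k : slice_measure k set0 = 0%E.
Proof. by rewrite /slice_measure set0I integral_set0. Qed.
Let slice_ge0 k B : (0 <= slice_measure k B)%E.
Proof. by apply: integral_ge0 => w _; rewrite lee_fin. Qed.
Let slice_sigma k : semi_sigma_additive (slice_measure k).
Proof.
move=> B mB tB mUB; rewrite /slice_measure setI_bigcupl.
apply: (@semi_sigma_additive_nng_induced _ _ _ P (EFin \o Z)) => //.
- by move=> i; apply: measurableI => //; exact: measST.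
- exact: trivIset_setIr.
- by apply: bigcup_measurable => i _; apply: measurableI => //; exact: measST.
Qed.

HB.instance Definition _ k :=
  isMeasure.Build _ S R (slice_measure k)
    (slice0 k) (slice_ge0 k) (@slice_sigma k).

Let slice_le k (B : set S) : measurable B ->
  (slice_measure k B <= k.+1%:R%:E * restr_proba B)%E.
Proof.
move=> mB; have mBT := measST mB; have mBl := measurableI _ _ mBT (mlevel k).
apply: (@le_trans _ _ (\int[P]_(w in B `&` slice k) (cst k.+1%:R%:E) w)%E).
  apply: ge0_le_integral => //=.
  - by move=> w _; rewrite lee_fin.
  - exact: measurable_funTS.
  - by move=> w [_]; rewrite /slice/= in_itv/= lee_fin => /andP[_ /ltW].
rewrite integral_cst// lee_wpmul2l// ?lee_fin// le_measure ?inE//.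
Qed.

Let slice_fin k : fin_num_fun (slice_measure k).
Proof.
move=> B mB; rewrite ge0_fin_numE ?slice_ge0//.
by apply: (le_lt_trans (slice_le k mB)); rewrite lte_mul_pinfty// ?lee_fin//
  (le_lt_trans (probability_le1 P (measST mB)))// ltry.
Qed.

HB.instance Definition _ k := @Measure_isFinite.Build _ S R (slice_measure k)
  (slice_fin k).

Let slice_dominated k : slice_measure k `<< restr_proba.
Proof.
apply/null_content_dominatesP => B mB PB0.
apply/eqP; rewrite eq_le slice_ge0 andbT.
by rewrite (le_trans (slice_le k mB))// PB0 mule0.
Qed.

Lemma condexp_exists : exists Y : T -> \bar R, is_condexp F Z Y.
Proof.
have /choice[g gP] k := radon_nikodym_sigma_finite (slice_dominated k).
have g0 k w : (0 <= g k w)%E by have [] := gP k.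
have mg k : measurable_fun (setT : set S) (g k).
  by have [_ _ /measurable_int] := gP k.
pose Y w := (\sum_(0 <= k <oo) g k w)%E.
have mY : measurable_fun (setT : set S) Y.
  by apply: ge0_emeasurable_sum => // k w _ _; exact: g0.
exists Y; split=> [U mU|B FB].
  by rewrite -measS -[_ @^-1` _]setTI; exact: mY.
have mB : measurable (B : set S) by rewrite measS.
have mBT := FT FB.
pose toS (w : T) : S := w.
have mtoS : measurable_fun setT toS by move=> _ C; rewrite setTI; exact: measST.
have Y0 w : (0 <= Y w)%E by apply: nneseries_ge0.
transitivity (\int[restr_proba]_(w in B) Y w)%E.
  symmetry.
  apply: (ge0_integral_pushforward mtoS P mB) => //.
  exact: measurable_funTS.
rewrite integral_nneseries//; last by move=> k; exact: measurable_funTS.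
transitivity (\sum_(0 <= k <oo) slice_measure k B)%E.
  by apply: eq_eseriesr => k _; have [_ _ _ ->] := gP k.
rewrite [in RHS](_ : B = \bigcup_k (B `&` slice k)); last first.
  rewrite -setI_bigcupr; apply/esym/setIidPl => w _.
  exists (Num.truncn (Z w)) => //; rewrite /slice/= in_itv/=.
  exact: truncn_itv.
have tl : trivIset setT (fun k => B `&` slice k).
  apply: trivIset_setIl; apply/trivIsetP => i j _ _ ij.
  apply/seteqP; split=> // w [] ; rewrite /slice/= !in_itv/=.
  move=> /truncn_def wi /truncn_def wj.
  by move/eqP: ij; apply; rewrite -wi -wj.
rewrite (@ge0_integral_bigcup _ _ _ P _ (EFin \o Z))//=.
- by move=> k; exact: measurableI.
- exact: measurable_funTS.
- by move=> w _; rewrite lee_fin.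
Qed.

Lemma condexpP : is_condexp F Z (condexp F Z).
Proof. by apply: xgetPex; exact: condexp_exists. Qed.

End existence.
End probability.

(* Main.v *)
Require Import Defs.
From mathcomp Require Import all_boot all_order all_algebra.
From mathcomp Require Import all_classical all_reals all_analysis.
From mathcomp Require Import measurable_realfun.
From mathcomp Require Import ring lra.

Set Implicit Arguments.
Unset Strict Implicit.
Unset Printing Implicit Defensive.

Import Order.TTheory GRing.Theory Num.Theory.
Import numFieldNormedType.Exports.

Local Open Scope classical_set_scope.
Local Open Scope ring_scope.

(** Write J for the matrix with all entries 1/n and M = A^T A. The disagreement
    V(X) is the quadratic form of I - J, and, A being doubly stochastic,
    A^T (I - J) A = M - J, so that V(X) - V(AX) is the quadratic form of I - M
    ([lyapunov_mul]). For a doubly stochastic M the form of I - M is that of a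
    weighted graph Laplacian: half the sum of M_ij |x_i - x_j|^2 over all
    ordered pairs ([energy_trace]). Keeping only the pairs (i, j) and (j, i)
    gives, for every fixed pair,
      V(AX) + M_ij |x_i - x_j|^2 <= V(X)            ([lyapunov_mul_le]).

    The Laplacian identity with M = J also writes V(X) as a sum over pairs.
    Along a shortest path from i to j each step is at most the length L of the
    max-edge, hence |x_i - x_j| <= diam L, and summing over the n (n - 1) pairs
    bounds V(X) by (n - 1) diam^2 L^2 / 2 ([lyapunov_le_max_edge]). A decrease
    by delta L^2 is therefore a decrease by the fraction
    2 delta / ((n - 1) diam^2) of V(X).

    It remains to take conditional expectations in the first inequality, where
    V(X) and |x_i - x_j|^2 are measurable for the conditioning sigma-algebra:
    wherever E[M_ij | F] >= delta, one gets
    E[V(AX) | F] <= V(X) - delta |x_i - x_j|^2 ([condexp_le_gap]). This is done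
    for each of the finitely many deterministic pairs (i, j), and the random
    pair of the max-edge is substituted afterwards, pointwise; so the random
    indices never appear under a conditional expectation. *)

(** * The disagreement as a quadratic form *)

Section energy.
Context {R : realType}.

Lemma enorm_sqr d (u : 'rV[R]_d) : enorm u ^+ 2 = \sum_k u 0 k ^+ 2.
Proof. by rewrite sqr_sqrtr// sumr_ge0// => k _; rewrite sqr_ge0. Qed.

Lemma enorm_subC d (u v : 'rV[R]_d) : enorm (u - v) = enorm (v - u).
Proof.
by congr Num.sqrt; apply: eq_bigr => k _; rewrite !mxE; ring.
Qed.

(** The Dirichlet form, over ordered pairs, of the graph with weights [M]. *)
Definition energy n d (M : 'M[R]_n) (X : 'M[R]_(n, d)) : R :=
  \sum_i \sum_j M i j * enorm (row i X - row j X) ^+ 2.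

(** Orthogonal projection, columnwise, onto the consensus states. *)
Definition averaging n : 'M[R]_n := const_mx n%:R^-1.

Lemma doubly_stochastic_col n (A : 'M[R]_n) j : doubly_stochastic A ->
  \sum_i A i j = 1.
Proof. by case=> _ [_ /(_ j) <-]; apply: eq_bigr => i _; rewrite mxE. Qed.

Lemma mxtrace_quadratic n d (N : 'M[R]_n) (X : 'M[R]_(n, d)) :
  \tr (X^T *m N *m X) = \sum_i \sum_j \sum_k N i j * (X i k * X j k).
Proof.
rewrite /mxtrace [RHS]exchange_big /=.
under [RHS]eq_bigr do rewrite exchange_big /=.
rewrite [RHS]exchange_big /=; apply: eq_bigr => k _; rewrite mxE.
apply: eq_bigr => j _; rewrite mxE big_distrl /=.
by apply: eq_bigr => i _; rewrite mxE; ring.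
Qed.

Lemma doubly_stochastic_averaging n : (0 < n)%N ->
  doubly_stochastic (averaging n).
Proof.
move=> n0; rewrite /doubly_stochastic trmx_const.
suff: stochastic (averaging n) by [].
split=> [i j|i]; first by rewrite mxE invr_ge0 ler0n.
under eq_bigr do rewrite mxE.
by rewrite sumr_const card_ord -[_^-1 *+ n]mulr_natr mulVf// pnatr_eq0 -lt0n.
Qed.

Lemma doubly_stochastic_gram n (A : 'M[R]_n) : doubly_stochastic A ->
  doubly_stochastic (A^T *m A).
Proof.
move=> [[A0 Ar] [_ Ac]]; rewrite /doubly_stochastic trmx_mul trmxK.
suff: stochastic (A^T *m A) by [].
split=> [i j|i].
  by rewrite mxE sumr_ge0// => k _; rewrite mulr_ge0// mxE.
under eq_bigr do rewrite mxE.
rewrite exchange_big /= -[RHS](Ac i); apply: eq_bigr => k _.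
by rewrite -mulr_sumr Ar mulr1.
Qed.

(** Expanding the square, the two square terms each give the full sum of
    squares because rows and columns of [M] sum to one, and the cross terms are
    twice the quadratic form of [M]. *)
Lemma energy_trace n d (M : 'M[R]_n) (X : 'M[R]_(n, d)) :
  doubly_stochastic M ->
  energy M X = 2 * \tr (X^T *m (1%:M - M) *m X).
Proof.
move=> dM; have [[_ Mr] _] := dM.
rewrite mulmxBr mulmxBl raddfB /= !mxtrace_quadratic.
pose S := \sum_i \sum_k X i k ^+ 2.
have -> : \sum_i \sum_j \sum_k (1%:M : 'M[R]_n) i j * (X i k * X j k) = S.
  apply: eq_bigr => i _; rewrite (bigD1 i)//= [X in _ + X]big1 ?addr0.
    by apply: eq_bigr => k _; rewrite mxE eqxx mul1r expr2.
  by move=> j ji; rewrite big1// => k _; rewrite mxE eq_sym (negbTE ji) mul0r.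
have Sl : \sum_i \sum_j \sum_k M i j * X i k ^+ 2 = S.
  apply: eq_bigr => i _; rewrite exchange_big /=; apply: eq_bigr => k _.
  by rewrite -mulr_suml Mr mul1r.
have Sr : \sum_i \sum_j \sum_k M i j * X j k ^+ 2 = S.
  rewrite exchange_big /=; apply: eq_bigr => j _.
  rewrite exchange_big /=; apply: eq_bigr => k _; rewrite -mulr_suml.
  by rewrite doubly_stochastic_col ?mul1r.
rewrite mulrBr [2 * S]mulr_natl mulr2n -{1}Sl -Sr.
rewrite -big_split /= mulr_sumr -sumrB; apply: eq_bigr => i _.
rewrite -big_split /= mulr_sumr -sumrB; apply: eq_bigr => j _.
rewrite -big_split /= mulr_sumr -sumrB enorm_sqr mulr_sumr.
by apply: eq_bigr => k _; rewrite !mxE; ring.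
Qed.

(** Averaging with column sums one keeps the mean of the rows. *)
Lemma averaging_mul n (A : 'M[R]_n) : doubly_stochastic A ->
  averaging n *m A = averaging n.
Proof.
move=> dA; apply/matrixP => i j; rewrite !mxE.
under eq_bigr do rewrite mxE.
by rewrite -mulr_sumr doubly_stochastic_col ?mulr1.
Qed.

Lemma averaging_mul_row n d (X : 'M[R]_(n, d)) (i : 'I_n) :
  row i (averaging n *m X) = row_mean X.
Proof.
apply/rowP => k; rewrite !mxE summxE mulr_sumr.
by apply: eq_bigr => j _; rewrite !mxE.
Qed.

(** The deviations from the mean are the rows of (I - J) X, and I - J is a
    symmetric idempotent. *)
Lemma lyapunov_trace n d (X : 'M[R]_(n, d)) : (0 < n)%N ->
  lyapunov X = \tr (X^T *m (1%:M - averaging n) *m X).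
Proof.
move=> n0; set J := averaging n.
have JT : J^T = J by rewrite trmx_const.
have JJ : J *m J = J by exact/averaging_mul/doubly_stochastic_averaging.
transitivity (\tr ((X - J *m X)^T *m (X - J *m X))).
  rewrite -[_^T]mulmx1 mxtrace_quadratic; apply: eq_bigr => i _.
  rewrite -(averaging_mul_row X i) enorm_sqr (bigD1 i)//= [X in _ = _ + X]big1.
    rewrite addr0; apply: eq_bigr => k _; rewrite !mxE eqxx mul1r.
    by rewrite expr2.
  by move=> j ji; rewrite big1// => k _; rewrite mxE eq_sym (negbTE ji) mul0r.
have -> : X - J *m X = (1%:M - J) *m X by rewrite mulmxBl mul1mx.
rewrite trmx_mul [(1%:M - J)^T]linearB /= trmx1 JT; congr (\tr _).
have idem : (1%:M - J) *m (1%:M - J) = 1%:M - J.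
  by rewrite mulmxBr mulmx1 mulmxBl mul1mx JJ subrr subr0.
by rewrite !mulmxA -[X^T *m _ *m (1%:M - J)]mulmxA idem.
Qed.

Lemma lyapunov_energy n d (X : 'M[R]_(n, d)) : (0 < n)%N ->
  lyapunov X = 2^-1 * energy (averaging n) X.
Proof.
move=> n0; rewrite lyapunov_trace// energy_trace; last first.
  exact: doubly_stochastic_averaging.
by rewrite mulrA mulVf ?mul1r// pnatr_eq0.
Qed.

Lemma lyapunov_mul n d (A : 'M[R]_n) (X : 'M[R]_(n, d)) : (0 < n)%N ->
  doubly_stochastic A ->
  lyapunov (A *m X) = lyapunov X - 2^-1 * energy (A^T *m A) X.
Proof.
move=> n0 dA; rewrite energy_trace; last exact: doubly_stochastic_gram.
rewrite mulrA mulVf ?pnatr_eq0// mul1r !lyapunov_trace// -raddfB /=.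
set J := averaging n; have JA : J *m A = J by exact: averaging_mul.
have AJ : A^T *m J = J.
  have JT : J^T = J by rewrite trmx_const.
  by rewrite -{1}JT -trmx_mul JA.
rewrite trmx_mul -mulmxBl -mulmxBr.
have -> : 1%:M - J - (1%:M - A^T *m A) = A^T *m A - J.
  by rewrite opprB addrC addrA subrK.
congr (\tr _).
rewrite !mulmxA; congr (_ *m _); rewrite -!mulmxA; congr (_ *m _).
by rewrite mulmxBl mul1mx JA mulmxBr AJ.
Qed.

End energy.

(** * Lower bound on the decrease through the longest edge *)

Section graph_bounds.
Context {R : realType} {n d : nat}.
Implicit Types (A : 'M[R]_n) (X : 'M[R]_(n, d)) (e : rel 'I_n).

(** All terms of the Dirichlet form are non-negative; the pairs (i, j) and
    (j, i) contribute equally because A^T A is symmetric, which cancels the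
    factor one half. *)
Lemma lyapunov_mul_le A X i j : doubly_stochastic A -> i != j ->
  lyapunov (A *m X) + (A^T *m A) i j * enorm (row i X - row j X) ^+ 2
    <= lyapunov X.
Proof.
move=> dA ij; have n0 : (0 < n)%N := leq_ltn_trans (leq0n i) (ltn_ord i).
rewrite lyapunov_mul//; set M := A^T *m A.
have [[M0 _] _] : doubly_stochastic M by exact: doubly_stochastic_gram.
have MT : M j i = M i j by rewrite -[M in LHS]trmxK mxE trmx_mul trmxK.
have F0 k l : 0 <= M k l * enorm (row k X - row l X) ^+ 2.
  by rewrite mulr_ge0// sqr_ge0.
suff : (M i j * enorm (row i X - row j X) ^+ 2) *+ 2 <= energy M X by lra.
have row_ge k l : M k l * enorm (row k X - row l X) ^+ 2 <=
    \sum_m M k m * enorm (row k X - row m X) ^+ 2.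
  by rewrite (bigD1 l)//= lerDl sumr_ge0.
rewrite /energy (bigD1 i)//= (bigD1 (P := fun k => k != i) j) 1?eq_sym//=.
rewrite mulr2n lerD ?row_ge// -[leLHS]addr0 lerD ?sumr_ge0//.
  by rewrite enorm_subC -MT row_ge.
by move=> k _; rewrite sumr_ge0.
Qed.

(** A shortest path visits no vertex twice, so it is found among the lengths
    below n and [gdist] does not return its default value. *)
Lemma gdist_walk e i j : connected_graph e -> has_walk e i j (gdist e i j).
Proof.
move=> /(_ i j)/connectP[p ep ->]; case/shortenP: ep => q eq uq _.
have sq : (size q < n)%N.
  by have := max_card (mem (i :: q)); rewrite card_ord (card_uniqP uq).
have hq : has (has_walk e i (last i q)) (iota 0 n).
  apply/hasP; exists (size q); first by rewrite mem_iota.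
  by apply/existsP; exists (in_tuple q); rewrite eq/=.
have := nth_find 0%N hq; rewrite nth_iota//.
by move: hq; rewrite has_find size_iota.
Qed.

Lemma gdist_le_diam e i j : (gdist e i j <= diam e)%N.
Proof.
apply: leq_trans (leq_bigmax i); exact: (leq_bigmax j).
Qed.

(** The triangle inequality in the only form needed to add up a walk edge by
    edge, so that no square root has to be taken. It follows coordinatewise from
    (a + b)^2 <= (1 + m) a^2 + (1 + 1/m) b^2. *)
Lemma enorm_sqrD_le m (u v : 'rV[R]_d) (L : R) :
  enorm u ^+ 2 <= L -> enorm v ^+ 2 <= m%:R ^+ 2 * L ->
  enorm (u + v) ^+ 2 <= m.+1%:R ^+ 2 * L.
Proof.
move=> uL vL; case: m => [|m] in vL *.
  have v0 : v = 0.
    apply/rowP => k; apply/eqP; rewrite mxE -sqrf_eq0 eq_le sqr_ge0 andbT.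
    move: vL; rewrite enorm_sqr expr0n mul0r (bigD1 k)//=.
    by apply: le_trans; rewrite lerDl sumr_ge0// => l _; rewrite sqr_ge0.
  by rewrite v0 addr0 expr1n mul1r.
have m0 : 0 < m.+1%:R :> R by rewrite ltr0n.
rewrite -[m.+2%:R]natr1; set c := m.+1%:R in m0 vL *.
have : enorm (u + v) ^+ 2 <= (1 + c) * enorm u ^+ 2 + (1 + c^-1) * enorm v ^+ 2.
  rewrite !enorm_sqr !mulr_sumr -big_split ler_sum//= => k _; rewrite mxE.
  (* the two sides differ by (c u - v)^2 / c *)
  have := sqr_ge0 (c * u 0 k - v 0 k).
  rewrite -(pmulr_rge0 _ (_ : 0 < c^-1)) ?invr_gt0// => h.
  rewrite -subr_ge0 (le_trans h)// le_eqVlt; apply/orP; left; apply/eqP.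
  by field; rewrite gt_eqF.
move/le_trans; apply.
have -> : (c + 1) ^+ 2 * L = (1 + c) * L + (1 + c^-1) * (c ^+ 2 * L).
  by field; rewrite gt_eqF.
by rewrite lerD// ler_wpM2l// addr_ge0// ?invr_ge0 ltW.
Qed.

Lemma walk_enorm_le e X L i p :
  (forall k l, e k l -> enorm (row k X - row l X) ^+ 2 <= L) ->
  path e i p ->
  enorm (row i X - row (last i p) X) ^+ 2 <= (size p)%:R ^+ 2 * L.
Proof.
move=> eL; elim: p i => [|j p IHp] i /=.
  rewrite subrr enorm_sqr big1 ?expr0n ?mul0r// => k _.
  by rewrite mxE expr0n.
case/andP=> eij /IHp IH.
by rewrite -(subrK (row j X) (row i X)) -addrA enorm_sqrD_le// eL.
Qed.

(** In the pair formula for the disagreement, each of the n (n - 1)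
    off-diagonal terms is at most (diam^2 L) / n. *)
Lemma lyapunov_le_edge e X L : (0 < n)%N -> connected_graph e -> 0 <= L ->
  (forall k l, e k l -> enorm (row k X - row l X) ^+ 2 <= L) ->
  lyapunov X <= 2^-1 * ((n%:R - 1) * (diam e)%:R ^+ 2 * L).
Proof.
move=> n0 ec L0 eL.
rewrite lyapunov_energy// ler_wpM2l ?invr_ge0//.
set B := (diam e)%:R ^+ 2 * L.
have B0 : 0 <= B by rewrite mulr_ge0 ?sqr_ge0.
have pair i j : enorm (row i X - row j X) ^+ 2 <= B.
  have /existsP[p /andP[ep /eqP <-]] := gdist_walk i j ec.
  apply: le_trans (walk_enorm_le eL ep) _.
  by rewrite size_tuple ler_wpM2r// lerXn2r ?nnegrE// ler_nat gdist_le_diam.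
have -> : (n%:R - 1) * (diam e)%:R ^+ 2 * L =
          \sum_(i < n) \sum_(j < n | j != i) n%:R^-1 * B.
  under eq_bigr do rewrite sumr_const cardC1 card_ord.
  rewrite sumr_const card_ord -[_ *+ n]mulr_natr -[_ *+ n.-1]mulr_natr.
  rewrite -subn1 natrB// /B.
  by field; rewrite pnatr_eq0 -lt0n.
apply: ler_sum => i _; rewrite (bigD1 i)//= subrr [enorm 0 ^+ 2]enorm_sqr.
rewrite [\sum_k _]big1 ?mulr0 ?add0r => [|k _]; last by rewrite mxE expr0n.
by apply: ler_sum => j _; rewrite mxE ler_wpM2l// invr_ge0.
Qed.

Lemma lyapunov_le_max_edge e X p : simple_graph e -> connected_graph e ->
  is_max_edge e X p ->
  lyapunov X <=
    2^-1 * ((n%:R - 1) * (diam e)%:R ^+ 2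
            * enorm (row p.1 X - row p.2 X) ^+ 2).
Proof.
move=> [es ei] ec [_ _ pmax].
have n0 : (0 < n)%N := leq_ltn_trans (leq0n p.1) (ltn_ord p.1).
apply: lyapunov_le_edge => //; first exact: sqr_ge0.
have sorted (k l : 'I_n) : (k < l)%N -> e k l ->
    enorm (row k X - row l X) ^+ 2 <= enorm (row p.1 X - row p.2 X) ^+ 2.
  move=> kl ekl; have [le_kl _] := pmax (k, l) kl ekl.
  by rewrite lerXn2r// nnegrE sqrtr_ge0.
move=> k l ekl; have [kl|lk|kl] := ltngtP k l; first exact: sorted.
  by rewrite enorm_subC sorted// es.
by move: ekl; rewrite (ord_inj kl) ei.
Qed.

End graph_bounds.

(** * Bounding conditional expectations from a pointwise inequality *)

Section conditional_expectation.
Context {disp : measure_display} {T : measurableType disp} {R : realType}.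
Variables (P : probability T R) (F : set (set T)).
Hypotheses (sF : sigma_algebra setT F) (FT : F `<=` measurable).

Local Notation S := (g_sigma_algebraType F).

Lemma sub_measurable_fun disp' (U : measurableType disp') (f : T -> U) :
  measurable_fun (setT : set S) f -> measurable_fun (setT : set T) f.
Proof.
move=> mf _ B mB; apply: FT.
by rewrite -(measurable_g_measurableTypeE sF); exact: (mf measurableT B mB).
Qed.

Lemma condexp_measurable (Z : T -> R) : measurable_fun setT Z ->
  (forall w, 0 <= Z w) -> measurable_fun (setT : set S) (condexp P F Z).
Proof.
move=> mZ Z0 _ B mB; rewrite setTI (measurable_g_measurableTypeE sF).
by have [+ _] := condexpP P sF FT mZ Z0; apply.
Qed.

(** For s < 0 the bound holds because Z is non-negative; allowing this case
    spares a proof that the chosen version of E[Z | F] is non-negative. *)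
Lemma condexp_ge_prob (Z : T -> R) (s : R) (C : set T) :
  measurable_fun setT Z -> (forall w, 0 <= Z w) -> F C ->
  (forall w, C w -> (s%:E <= condexp P F Z w)%E) ->
  (s%:E * P C <= \int[P]_(w in C) (Z w)%:E)%E.
Proof.
move=> mZ Z0 FC Cs; have mC := FT FC.
have [s0|s0] := leP 0 s; last first.
  apply: (@le_trans _ _ 0%E); last by apply: integral_ge0 => w _; rewrite lee_fin.
  by rewrite mule_le0_ge0// lee_fin ltW.
have [_ /(_ C FC) <-] := condexpP P sF FT mZ Z0.
rewrite -integral_cst//; apply: ge0_le_integral => //.
apply: measurable_funTS; apply: sub_measurable_fun.
exact: condexp_measurable.
Qed.

(** Conditioning Z + M l <= v gives E[Z | F] + l E[M | F] <= v. Rather than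
    pulling the F-measurable functions l and v out of the conditional
    expectation, they are frozen at rational bounds: where the conclusion fails
    there are rationals a >= v, 0 <= b <= l and s <= E[Z | F] with
    a < s + delta b. On the corresponding event C of F, integrating the
    hypothesis gives (s + delta b) P(C) <= a P(C), so P(C) = 0, and there are
    countably many such events. *)
Lemma condexp_le_gap (Z M v l : T -> R) (delta : R) :
  measurable_fun setT Z -> (forall w, 0 <= Z w) ->
  measurable_fun setT M -> (forall w, 0 <= M w) ->
  measurable_fun (setT : set S) v ->
  measurable_fun (setT : set S) l -> (forall w, 0 <= l w) ->
  (forall w, Z w + M w * l w <= v w) -> 0 < delta ->
  {ae P, forall w, (delta%:E <= condexp P F M w)%E ->
     (condexp P F Z w <= (v w - delta * l w)%:E)%E}.
Proof.
move=> mZ Z0 mM M0 mv ml l0 Zv delta0.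
pose Y := condexp P F Z; pose c := condexp P F M.
pose C (a b s : R) : set T :=
  [set w | v w <= a] `&` [set w | b <= l w] `&`
  [set w | (s%:E <= Y w)%E] `&` [set w | (delta%:E <= c w)%E].
have FC a b s : F (C a b s).
  rewrite -(measurable_g_measurableTypeE sF).
  have mY : measurable_fun (setT : set S) Y by exact: condexp_measurable.
  have mc : measurable_fun (setT : set S) c by exact: condexp_measurable.
  rewrite /C; apply: (@measurableI _ S); first apply: (@measurableI _ S);
    first apply: (@measurableI _ S).
  - rewrite -[X in measurable X]setTI.
    by apply: (@measurable_fun_le _ S _ setT v (cst a)).
  - rewrite -[X in measurable X]setTI.
    by apply: (@measurable_fun_le _ S _ setT (cst b) l).
  - rewrite -[X in measurable X]setTI.
    exact: (@emeasurable_fun_c_infty _ S _ setT Y).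
  - rewrite -[X in measurable X]setTI.
    exact: (@emeasurable_fun_c_infty _ S _ setT c).
have C0 a b s : 0 <= b -> a < s + delta * b -> P (C a b s) = 0%E.
  move=> b0 ab; have mC := FT (FC a b s).
  have hZ : (s%:E * P (C a b s) <= \int[P]_(w in C a b s) (Z w)%:E)%E.
    by apply: condexp_ge_prob => // w [[_ +] _].
  have hM : (delta%:E * P (C a b s) <= \int[P]_(w in C a b s) (M w)%:E)%E.
    by apply: condexp_ge_prob => // w [_ +].
  have : (\int[P]_(w in C a b s) (Z w)%:E +
          b%:E * \int[P]_(w in C a b s) (M w)%:E <= a%:E * P (C a b s))%E.
    rewrite -integral_cst// -ge0_integralZl_EFin//; first last.
    - by apply/measurable_EFinP; exact: measurable_funTS.
    - by move=> w _; rewrite lee_fin.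
    rewrite -ge0_integralD//; first last.
    - by apply: measurable_funeM; apply/measurable_EFinP; exact: measurable_funTS.
    - by move=> w _; rewrite -EFinM lee_fin mulr_ge0.
    - by apply/measurable_EFinP; exact: measurable_funTS.
    - by move=> w _; rewrite lee_fin.
    apply: ge0_le_integral => //.
    - by move=> w _; rewrite -EFinM -EFinD lee_fin addr_ge0// mulr_ge0.
    - apply: emeasurable_funD; last apply: measurable_funeM;
        by apply/measurable_EFinP; exact: measurable_funTS.
    - move=> w [[[/= va bl] _] _]; rewrite -EFinM -EFinD lee_fin.
      apply: le_trans va; apply: le_trans (Zv w).
      by rewrite lerD2l mulrC ler_wpM2l.
  move=> h; have {}h := le_trans (leeD hZ (lee_wpmul2l _ hM)) h.
  have /fineK Pf : P (C a b s) \is a fin_num by exact: fin_num_measure.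
  move: h; rewrite -Pf -!EFinM -EFinD !lee_fin => /(_ b0) h.
  have p0 : 0 <= fine (P (C a b s)) by rewrite fine_ge0.
  congr EFin; nra.
pose D (q : rat * rat * rat) : set T :=
  if (0 <= q.1.2) && (ratr q.1.1 < ratr q.2 + delta * ratr q.1.2) then
    C (ratr q.1.1) (ratr q.1.2) (ratr q.2) else set0.
have D0 q : P.-negligible (D q).
  rewrite /D; case: ifP => [/andP[q0 q1]|_]; last exact: negligible_set0.
  exists (C (ratr q.1.1) (ratr q.1.2) (ratr q.2)); split => //.
    exact/FT/FC.
  by apply: C0 => //; rewrite ler0q.
have : P.-negligible (\bigcup_k (if unpickle k is Some q then D q else set0)).
  apply: negligible_bigcup => k; case: (unpickle k) => [q|] //.
  exact: negligible_set0.
apply: negligibleS => w /= /not_implyP[cw /negP]; rewrite -ltNge => Yw.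
suff [a [b [s [b0 [abs Cw]]]]] : exists a b s : rat, 0 <= b /\
    ratr a < ratr s + delta * ratr b /\ C (ratr a) (ratr b) (ratr s) w.
  exists (pickle (a, b, s)); first exact: I.
  by rewrite pickleK /D /= b0 abs.
have [s [/= vs sY]] : exists s : rat,
    v w - delta * l w < ratr s /\ ((ratr s)%:E <= Y w)%E.
  move: Yw; rewrite -/Y; case: (Y w) => [y| |//].
  - rewrite lte_fin => /rat_in_itvoo[s]; rewrite in_itv/= => /andP[vs sy].
    by exists s; rewrite lee_fin ltW.
  - move=> _; have [|s] := @rat_in_itvoo R (v w - delta * l w) (v w - delta * l w + 1).
      by rewrite ltrDl.
    by rewrite in_itv/= => /andP[vs _]; exists s; rewrite leey.
(* [eta] is half of the violation: one half pays for a - v, the other for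
   delta (l - b). *)
pose eta := (ratr s - (v w - delta * l w)) / 2.
have eta0 : 0 < eta by rewrite divr_gt0// subr_gt0.
have [a] : exists a : rat, ratr a \in `]v w, v w + eta[.
  by apply: rat_in_itvoo; rewrite ltrDl.
rewrite in_itv/= => /andP[va av].
have [b [b0 [bl lb]]] : exists b : rat,
    0 <= b /\ ratr b <= l w /\ l w - eta / delta < ratr b.
  have := l0 w; rewrite le_eqVlt => /orP[/eqP <-|lw].
    (* when l = 0 the bound b must be 0 itself, as b must not be negative *)
    by exists 0; rewrite lexx rmorph0 lexx sub0r oppr_lt0 divr_gt0.
  have [|b] := @rat_in_itvoo R (Num.max 0 (l w - eta / delta)) (l w).
    by rewrite gt_max lw/= gtrBl divr_gt0.
  rewrite in_itv/= gt_max => /andP[/andP[b0 lb] bl].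
  by exists b; rewrite -(ler0q R) !ltW.
exists a, b, s; split => //; split; last first.
  by do 3?split => //=; exact: ltW.
have : delta * l w - eta < delta * ratr b.
  move: lb; rewrite -(ltr_pM2l delta0); congr (_ < _).
  by field; rewrite gt_eqF.
move: av; rewrite /eta; lra.
Qed.

End conditional_expectation.

(** * Measurability of random matrices and of the history *)

Lemma measurable_lyapunov disp (S : measurableType disp) (R : realType) n d
  (M : S -> 'M[R]_(n, d)) :
  (forall i j, measurable_fun setT (fun w => M w i j)) ->
  measurable_fun setT (fun w => lyapunov (M w)).
Proof.
move=> mM; rewrite /lyapunov /row_mean.
under eq_fun do under eq_bigr do rewrite enorm_sqr.
apply: measurable_sum => i; apply: measurable_sum => k.
apply: measurable_funX; under eq_fun do rewrite !mxE summxE.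
apply: measurable_funB => //; apply: measurable_funM; first exact: measurable_cst.
apply: measurable_sum => j; under eq_fun do rewrite mxE.
exact: mM.
Qed.

Lemma measurable_enorm_sqr disp (S : measurableType disp) (R : realType) n d
  (M : S -> 'M[R]_(n, d)) (i j : 'I_n) :
  (forall i j, measurable_fun setT (fun w => M w i j)) ->
  measurable_fun setT (fun w => enorm (row i (M w) - row j (M w)) ^+ 2).
Proof.
move=> mM; under eq_fun do rewrite enorm_sqr.
apply: measurable_sum => k; apply: measurable_funX.
by under eq_fun do rewrite !mxE; exact: measurable_funB.
Qed.

Lemma measurable_mulmx disp (S : measurableType disp) (R : realType) m n p
  (M : S -> 'M[R]_(m, n)) (N : S -> 'M[R]_(n, p)) :
  (forall i j, measurable_fun setT (fun w => M w i j)) ->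
  (forall i j, measurable_fun setT (fun w => N w i j)) ->
  forall i j, measurable_fun setT (fun w => (M w *m N w) i j).
Proof.
move=> mM mN i j; under eq_fun do rewrite mxE.
by apply: measurable_sum => k; exact: measurable_funM.
Qed.

Section random_matrices.
Context {disp : measure_display} {T : measurableType disp} {R : realType}.

Lemma measurable_mx_entry m n (M : T -> 'M[R]_(m, n)) i j :
  measurable_mx measurable M -> measurable_fun setT (fun w => M w i j).
Proof. by move=> mM _ U mU; rewrite setTI; apply: mM; exists i, j, U. Qed.

Section history.
Context {m n k l : nat}.
Variables (X : nat -> T -> 'M[R]_(m, n)) (A : nat -> T -> 'M[R]_(k, l)).
Variable t : nat.

Lemma history_sigma_algebra : sigma_algebra setT (history X A t).
Proof. exact: smallest_sigma_algebra. Qed.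

Lemma history_sub_measurable :
  (forall s, measurable_mx measurable (X s)) ->
  (forall s, measurable_mx measurable (A s)) ->
  history X A t `<=` measurable.
Proof.
move=> mX mA; apply: smallest_sub; first exact: sigma_algebra_measurable.
by move=> B [[s _ /mX]|[s _ /mA]].
Qed.

Lemma history_measurable_entry i j :
  measurable_fun (setT : set (g_sigma_algebraType (history X A t)))
    (fun w => X t w i j).
Proof.
move=> _ U mU; rewrite setTI.
rewrite (measurable_g_measurableTypeE history_sigma_algebra).
apply: sub_sigma_algebra; left; exists t; first by rewrite /= leqnn.
by exists i, j, U.
Qed.

End history.
End random_matrices.

(** * Expected contraction *)

Theorem theorem3 (R : realType) (disp : measure_display)
  (T : measurableType disp) (P : probability T R)
  (n d : nat) (n_ge2 : (2 <= n)%N)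
  (e : rel 'I_n) (e_simple : simple_graph e) (e_connected : connected_graph e)
  (f : 'I_n -> 'rV[R]_d -> R) (f_convex : forall i, convex_function setT (f i))
  (alpha : nat -> R)
  (A : nat -> 'M[R]_(n, d) -> T -> 'M[R]_n)
  (* processes indexed by the initial matrix X(0) *)
  (X W G : 'M[R]_(n, d) -> nat -> T -> 'M[R]_(n, d))
  (X_init : forall X0 w, X X0 0%N w = X0)
  (W_step : forall X0 t w, W X0 t.+1 w = along A (X X0) t w *m X X0 t w)
  (G_subgradient : forall X0 t w i,
     subgradient (f i) (row i (W X0 t.+1 w)) (row i (G X0 t.+1 w)))
  (X_step : forall X0 t w,
     X X0 t.+1 w = W X0 t.+1 w - alpha t.+1 *: G X0 t.+1 w)
  (X_random : forall X0 t, measurable_mx measurable (X X0 t))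
  (A_random : forall X0 t, measurable_mx measurable (along A (X X0) t))
  (A_adapted : forall X0 t,
     measurable_mx (history (X X0) (along A (X X0)) t.+1) (along A (X X0) t))
  (A_doubly_stochastic : forall X0 t w,
     doubly_stochastic (along A (X X0) t w))
  (istar jstar : 'M[R]_(n, d) -> nat -> T -> 'I_n)
  (max_edge : forall X0 t w,
     is_max_edge e (X X0 t w) (istar X0 t w, jstar X0 t w))
  (delta : R) (delta_gt0 : 0 < delta)
  (A_contracting : forall X0 t, {ae P, forall w,
     (delta%:E <=
      condexp_mx P (history (X X0) (along A (X X0)) t)
        (fun w' => (along A (X X0) t w')^T *m along A (X X0) t w') w
        (istar X0 t w) (jstar X0 t w))%E}) :
  let lambda := 1 - 2%:R * delta / ((n%:R - 1) * (diam e)%:R ^+ 2) in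
  forall X0 t, {ae P, forall w,
    (condexp P (history (X X0) (along A (X X0)) t)
       (fun w' => lyapunov (along A (X X0) t w' *m X X0 t w')) w
     <= (lambda * lyapunov (X X0 t w))%:E)%E}.
Proof.
move=> lambda X0 t; set A' := along A (X X0); set F := history _ _ t.
have mXT i j : measurable_fun setT (fun w => X X0 t w i j).
  exact/measurable_mx_entry/X_random.
have mAT i j : measurable_fun setT (fun w => A' t w i j).
  exact/measurable_mx_entry/A_random.
have sF : sigma_algebra setT F by exact: history_sigma_algebra.
have FT : F `<=` measurable.
  by apply: history_sub_measurable => s; [exact: X_random|exact: A_random].
have n0 : (0 < n)%N by exact: ltnW.
pose len (i j : 'I_n) w := enorm (row i (X X0 t w) - row j (X X0 t w)) ^+ 2.
pose gram w := (A' t w)^T *m A' t w.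
(* One almost sure inequality for each deterministic pair, so that their
   intersection can be evaluated at the random pair of the max-edge. *)
pose gap (ij : 'I_n * 'I_n) w := ij.1 != ij.2 ->
  (delta%:E <= condexp P F (fun w' => gram w' ij.1 ij.2) w)%E ->
  (condexp P F (fun w' => lyapunov (A' t w' *m X X0 t w')) w <=
   (lyapunov (X X0 t w) - delta * len ij.1 ij.2 w)%:E)%E.
have ae_gap ij : {ae P, forall w, gap ij w}.
  rewrite /gap; case: ij => i j /=; have [->|ij] := eqVneq i j; first exact: aeW.
  have gram0 w : 0 <= gram w i j.
    by have [[+ _] _] := doubly_stochastic_gram (A_doubly_stochastic X0 t w).
  have ae_ij : {ae P, forall w,
      (delta%:E <= condexp P F (fun w' => gram w' i j) w)%E ->
      (condexp P F (fun w' => lyapunov (A' t w' *m X X0 t w')) w <=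
       (lyapunov (X X0 t w) - delta * len i j w)%:E)%E}.
    apply: (condexp_le_gap P sF FT) => //.
    - by apply: measurable_lyapunov; exact: measurable_mulmx.
    - by move=> w; apply: sumr_ge0 => k _; exact: sqr_ge0.
    - apply: measurable_mulmx => // k l.
      by under eq_fun do rewrite mxE; exact: mAT.
    - by apply: measurable_lyapunov; exact: history_measurable_entry.
    - by apply: measurable_enorm_sqr; exact: history_measurable_entry.
    - by move=> w; exact: sqr_ge0.
    - by move=> w; exact: lyapunov_mul_le (A_doubly_stochastic X0 t w) ij.
  by apply: filterS ae_ij => w h _.
have ae_gaps : {ae P, forall w, forall ij, gap ij w}.
  exact: (@filter_forall _ _ gap (almost_everywhere P) _ ae_gap).
apply: filterS2 (A_contracting X0 t) ae_gaps => w.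
rewrite mxE => cw /(_ (istar X0 t w, jstar X0 t w)) /=.
have pmax := max_edge X0 t w; have [ij _ _] := pmax.
have {}ij : istar X0 t w != jstar X0 t w by move: ij; rewrite ltn_neqAle => /andP[].
move=> /(_ ij cw) /le_trans; apply; rewrite lee_fin.
have := lyapunov_le_max_edge e_simple e_connected pmax.
rewrite -/(len _ _ w) /lambda /=; set V := lyapunov _; set L := len _ _ w.
set K := _ * _ ^+ 2 => VL.
have K0 : 0 <= K by rewrite mulr_ge0 ?sqr_ge0// subr_ge0 ler1n.
have L0 : 0 <= L by exact: sqr_ge0.
have : 2 * delta / K * V <= delta * L.
  (* for K = 0 the quotient is 0 by the convention on inverses *)
  have [->|Kn0] := eqVneq K 0; first by rewrite invr0 mulr0 mul0r mulr_ge0// ltW.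
  have {}K0 : 0 < K by rewrite lt_def Kn0.
  have -> : 2 * delta / K * V = delta * (2 * V / K) by field.
  by apply: ler_wpM2l; [exact: ltW|rewrite ler_pdivrMr//; lra].
lra.
Qed.
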